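(* Let $p$ be an odd prime, let $1\le d\le n\le m$ be integers, and let $R$ be a local nearring with multiplicative identity $i$ whose additive group $R^+$ is isomorphic to $G(p^m,p^n,p^d)$. Let $R^+=\langle a\rangle+\langle b\rangle+\langle c\rangle$ with elements $a$, $b$ and $c$ satisfying the relations $ap^m=bp^n=cp^d=0$, $-b+a+b=a+c$ and $-a+c+a=-b+c+b=c$, where $a=i$ and each element $x\in R$ is uniquely written in the form $x=ax_1+bx_2+cx_3$ with coefficients $0\le x_1<p^m$, $0\le x_2<p^n$ and $0\le x_3<p^d$. Let $L$ be the set of all non-invertible elements of $R$. Then the following statements hold: (1) $L=\langle a\cdot p\rangle+\langle b\rangle+\langle c\rangle$ and, in particular, the subgroup $L$ is of index $p$ in $R^+$ and $|R^*|=p^{m+n+d-1}(p-1)$; (2) $x=ax_1+bx_2+cx_3$ is an invertible element if and only if $x_1\not\equiv 0 \pmod p$.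
   Context: For an odd prime $p$ and integers $1\le d\le n\le m$, $G(p^m,p^n,p^d)$ denotes the group $\langle a,b,c\mid a^{p^m}=b^{p^n}=c^{p^d}=1,\ a^b=ac,\ c^a=c^b=c\rangle$, where $x^y=y^{-1}xy$; it has order $p^{m+n+d}$. A nearring here is a left distributive nearring: a set $R$ with operations $+,\cdot$ such that $(R,+)=R^+$ is a (not necessarily abelian) group with neutral element $0$, $(R,\cdot)$ is a semigroup, and $x(y+z)=xy+xz$ for all $x,y,z\in R$. It has identity $i$ if $i$ is a two-sided identity of $(R,\cdot)$; then $R^*$ denotes the group of invertible elements of the monoid $(R,\cdot)$. A nearring with identity is called local if the set of all its non-invertible elements is a subgroup of $R^+$. The group $R^+$ is written additively (although it is non-abelian), and for $g\in R$ and an integer $k$, $gk$ (or $g\cdot k$) denotes the $k$-th multiple of $g$ in $R^+$; $\langle g\rangle$ denotes the subgroup of $R^+$ generated by $g$.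
   Formalization: When n=m the claim fails for some generators (replace b by i+b), so (1) and (2) are stated for all triples with a=i if n<m, and for those with b in L if n=m; existence of a triple with a=i and b in L is proved for every R. *)

(* Defs.v *)
From HB Require Import structures.
From mathcomp Require Import all_boot all_fingroup.

Set Implicit Arguments.
Unset Strict Implicit.
Unset Printing Implicit Defensive.

Local Open Scope group_scope.

(* The additive group of a nearring need not be abelian, so it is carried by   *)
(* MathComp's (multiplicatively written) group structures:                     *)
(*   0 ~> 1%g,  x + y ~> (x * y)%g,  - x ~> x^-1%g,  the multiple g k ~> g ^+ k, *)
(*   - y + x + y ~> x ^ y,  a sum of subsets A + B ~> (A * B)%g.                 *)
(* The nearring product is written x ** y, and its identity \id.               *)

(* In ssrfun's vocabulary x (y + z) = x y + x z, the left distributive law, is  *)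
(* right_distributive. The law 0 ** x = 0 is not required.                     *)
HB.mixin Record Group_isNearring R of monoid.Group R := {
  nrmul : R -> R -> R;
  nrmulA : associative nrmul;
  nrmulDr : right_distributive nrmul (@monoid.mul R)
}.

#[short(type="nearringType")]
HB.structure Definition Nearring := { R of Group_isNearring R & monoid.Group R }.

HB.mixin Record Nearring_hasIdentity R of Nearring R := {
  nrone : R;
  nrmul1l : left_id nrone (@nrmul R);
  nrmul1r : right_id nrone (@nrmul R)
}.

#[short(type="nearring1Type")]
HB.structure Definition Nearring1 :=
  { R of Nearring_hasIdentity R & Nearring R }.

#[short(type="finNearring1Type")]
HB.structure Definition FinNearring1 := { R of Nearring1 R & FinGroup R }.

Declare Scope nearring_scope.
Delimit Scope nearring_scope with NR.
Notation "x ** y" := (nrmul x y) (at level 40, left associativity)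
  : nearring_scope.
Notation "\id" := nrone (at level 0) : nearring_scope.
Local Open Scope nearring_scope.

Definition nrunits (R : finNearring1Type) : {set R} :=
  [set x | [exists y, (x ** y == \id) && (y ** x == \id)]].

Definition nrnonunits (R : finNearring1Type) : {set R} := ~: nrunits R.

Definition local_nearring (R : finNearring1Type) : bool :=
  group_set (nrnonunits R).

(* The presented group is finite, of order p ^ (m + n + d), so that \isog Grp  *)
(* does mean isomorphism with it.                                              *)
Definition isog_Gp (p m n d : nat) (gT : finGroupType) (G : {set gT}) : Prop :=
  G \isog Grp (a : b : c : (a ^+ (p ^ m)%N, b ^+ (p ^ n)%N, c ^+ (p ^ d)%N,
                            a ^ b = a * c, c ^ a = c, c ^ b = c)).

Record Gp_generators (p m n d : nat) (gT : finGroupType) (a b c : gT) : Prop :=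
  GpGenerators {
    Gp_gen  : [set: gT] = <[a]> * <[b]> * <[c]>;
    Gp_expa : a ^+ (p ^ m)%N = 1;
    Gp_expb : b ^+ (p ^ n)%N = 1;
    Gp_expc : c ^+ (p ^ d)%N = 1;
    Gp_ab   : a ^ b = a * c;
    Gp_ca   : c ^ a = c;
    Gp_cb   : c ^ b = c;
    Gp_coef : forall x : gT,
      exists! k : 'I_(p ^ m) * 'I_(p ^ n) * 'I_(p ^ d),
        x = a ^+ k.1.1 * b ^+ k.1.2 * c ^+ k.2
  }.

(* Main.v *)
Require Import Defs.
From mathcomp Require Import all_boot all_fingroup all_solvable.
From mathcomp Require Import ssralg zmodp.

Set Implicit Arguments.
Unset Strict Implicit.
Unset Printing Implicit Defensive.

Import GRing.Theory.
Local Open Scope group_scope.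
Local Open Scope nearring_scope.

(** Write G for the additive group of R, Phi for its Frattini subgroup and L
    for the set of non-units. By left distributivity, each left multiplication
    y |-> x ** y is an endomorphism of G, and if u is a unit then every element
    of G is the image of u under one of them. Hence a fully invariant subgroup
    that contains a unit is all of G, and the order of a unit is the exponent
    of G. The first fact gives Phi <= L ([Phi_sub_nonunits]); the second puts b
    in L as soon as n < m, because b is killed by p ^ n while the exponent of G
    is p ^ m ([Gp_nonunit_lt]).

    Once b lies in L, the rest is group theory: L contains a ^+ p and c, which
    lie in Phi, but not a = \id, so a ^+ x1 * b ^+ x2 * c ^+ x3 is in L exactly
    when p divides x1 ([Gp_mem_maximal]), and the index of L is p.

    The real content is that suitable generators \id, b, c with b in L exist
    when n = m. Any element b of L outside Phi will do: G / Phi has order at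
    most p ^ 2 and \id is not in L, so \id and b generate G, and since G has
    exponent p ^ n and its cyclic derived subgroup is central, the relations
    hold with c = [~ \id, b]; a count of the elements shows that the coordinates
    are unique. Such a b exists because L is not contained in Phi
    ([nonunits_not_sub_Phi]). Suppose that it is. Left multiplication by the
    opposite of \id is an involution alpha of G, and no unit is fixed by alpha
    because \id is not its own opposite (p is odd). As |G| is odd, any coset of
    Phi that alpha preserves contains a fixed point, so alpha fixes no
    nontrivial element of G / Phi and acts on it by inversion
    ([alpha_neg_mod_Phi]). Consequently alpha inverts G / G', so all its fixed
    points lie in G' ([fixed_der1]); and because commutators are bilinear, alpha
    fixes an element z of order p in G' ([alpha_der1_expg]). Every product
    z ** y is then fixed by alpha, so y |-> z ** y maps G into the cyclic
    group G'. Its kernel contains no unit, hence lies in L and so in Phi;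
    therefore G / Phi, and with it G, is cyclic, which contradicts G' != 1.

    The hypothesis on R only says that G is isomorphic to a presented group. A
    group of permutations of a finite set satisfies the relations and has at
    least p ^ (m + n + d) elements ([heis_rels], [heis_card]), so the presented
    group does not collapse and its generators have unique coordinates. *)

(** * A permutation model of the presented group *)

(** The relations alone, for triples that are not yet known to give unique
    coordinates. *)
Definition Gp_rels (p m n d : nat) (gT : finGroupType) (a b c : gT) : Prop :=
  [/\ a ^+ (p ^ m)%N = 1, b ^+ (p ^ n)%N = 1, c ^+ (p ^ d)%N = 1,
      a ^ b = a * c & c ^ a = c /\ c ^ b = c].

Section HeisenbergModel.

Variables (q M N : nat).
Hypotheses (q_gt1 : 1 < q) (qM : q %| M) (qN : q %| N).
Hypotheses (M_gt1 : 1 < M) (N_gt1 : 1 < N).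

Local Notation X := ('Z_q * 'Z_q * 'Z_M * 'Z_N)%type.

(** The Heisenberg group over the integers mod q acts on the first two
    coordinates; the last two count the occurrences of the first two generators
    modulo M and N, which restores the orders lost by reducing them modulo q. *)
Definition heis_fun (e : 'Z_q * 'Z_q * 'Z_q * 'Z_M * 'Z_N) (t : X) : X :=
  let: (u, v, w, r, s) := e in let: (x, y, z, k) := t in
  (x + u, y + w * x + v, z + r, k + s)%R.

Lemma heis_inj e : injective (heis_fun e).
Proof.
case: e => [[[[u v] w] r] s] [[[x y] z] k] [[[x' y'] z'] k'] /=.
move/eqP; rewrite !xpair_eqE -!andbA => /and4P[/eqP/addIr-> /eqP].
by move=> /addIr/addIr-> /eqP/addIr-> /eqP/addIr->.
Qed.

Definition heis e : {perm X} := perm (@heis_inj e).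
Definition heisA := heis (1, 0, 0, 1, 0)%R.
Definition heisB := heis (0, 0, 1, 0, 1)%R.
Definition heisC := heis (0, 1, 0, 0, 0)%R.

Lemma heisAX k : heisA ^+ k = heis (k%:R, 0, 0, k%:R, 0)%R.
Proof.
elim: k => [|k IHk]; apply/permP=> -[[[x y] z] t].
  by rewrite expg0 perm1 permE /= !mul0r !addr0.
by rewrite expgSr permM IHk !permE /= !mul0r !addr0 -!natr1 !addrA.
Qed.

Lemma heisBX k : heisB ^+ k = heis (0, 0, k%:R, 0, k%:R)%R.
Proof.
elim: k => [|k IHk]; apply/permP=> -[[[x y] z] t].
  by rewrite expg0 perm1 permE /= !mul0r !addr0.
by rewrite expgSr permM IHk !permE /= !addr0 -!natr1 !addrA mulrDl addrA.
Qed.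

Lemma heisCX k : heisC ^+ k = heis (0, k%:R, 0, 0, 0)%R.
Proof.
elim: k => [|k IHk]; apply/permP=> -[[[x y] z] t].
  by rewrite expg0 perm1 permE /= !mul0r !addr0.
by rewrite expgSr permM IHk !permE /= !mul0r !addr0 -!natr1 !addrA.
Qed.

Lemma Zp_natr0 r s : 1 < r -> r %| s -> (s%:R = 0 :> 'Z_r)%R.
Proof.
by move=> r_gt1 /eqP r_s; apply: val_inj; rewrite /= val_Zp_nat // r_s.
Qed.

Lemma heis_rels :
  [/\ heisA ^+ M = 1, heisB ^+ N = 1, heisC ^+ q = 1,
      heisA ^ heisB = heisA * heisC
    & heisC ^ heisA = heisC /\ heisC ^ heisB = heisC].
Proof.
have id0 : heis (0, 0, 0, 0, 0)%R = 1.
  by apply/permP=> -[[[x y] z] t]; rewrite perm1 permE /= !mul0r !addr0.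
rewrite heisAX heisBX heisCX !Zp_natr0 // id0; split=> //.
  apply/(mulgI heisB); rewrite conjgE mulKVg; apply/permP=> -[[[x y] z] t].
  by rewrite !permM !permE /= !mul1r !mul0r !addr0 addrA.
split; [apply/(mulgI heisA) | apply/(mulgI heisB)]; rewrite conjgE mulKVg;
  apply/permP=> -[[[x y] z] t]; rewrite !permM !permE /= ?mul0r !addr0 //.
by rewrite addrAC.
Qed.

Lemma heis_card : (M * N * q)%N <= #|<[heisA]> <*> <[heisB]> <*> <[heisC]>|.
Proof.
pose f (k : 'I_M * 'I_N * 'I_q) :=
  heisA ^+ k.1.1 * heisB ^+ k.1.2 * heisC ^+ k.2.
have f_inj : injective f.
  (* The image of the origin already determines the three exponents. *)
  move=> [[i j] k] [[i' j'] k'] /permP/(_ (0, 0, 0, 0)%R).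
  rewrite /f /= !heisAX !heisBX !heisCX !permM !permE /= !mul0r !addr0 !add0r.
  have natr_ord r (x y : 'I_r) : 1 < r -> (x%:R = y%:R :> 'Z_r)%R -> x = y.
    move=> r_gt1 /(congr1 (@nat_of_ord _)); rewrite !val_Zp_nat //.
    rewrite !modn_small //; exact: val_inj.
  move/eqP; rewrite !xpair_eqE -!andbA => /and4P[_ /eqP].
  move=> ek /eqP/(natr_ord _ _ _ M_gt1) ei /eqP/(natr_ord _ _ _ N_gt1) ej.
  by move: ek; rewrite ei ej => /addrI/(natr_ord _ _ _ q_gt1)->.
have -> : (M * N * q = #|codom f|)%N.
  by rewrite card_codom // !card_prod !card_ord.
apply/subset_leq_card/subsetP=> _ /codomP[k ->].
rewrite !groupM ?groupX // -cycle_subG ?joing_subr //.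
  exact: subset_trans (joing_subl _ _) (joing_subl _ _).
exact: subset_trans (joing_subr _ _) (joing_subl _ _).
Qed.

End HeisenbergModel.

(** * Generators and coordinates *)

Lemma homg_GpP (p m n d : nat) (gT : finGroupType) (G : {group gT}) :
  reflect (exists a b c, Gp_rels p m n d a b c
             /\ <[a]> <*> <[b]> <*> <[c]> = G)
    (G \homg Grp (a : b : c :
                    (a ^+ (p ^ m)%N, b ^+ (p ^ n)%N, c ^+ (p ^ d)%N,
                     a ^ b = a * c, c ^ a = c, c ^ b = c))).
Proof.
apply: (iffP existsP) => [[[[a b] c] /= /eqP[]] | ].
  by move=> defG ra rb rc rab rca rcb; exists a, b, c.
case=> a [b [c [[ra rb rc rab [rca rcb]] defG]]].
by exists (a, b, c) => /=; rewrite !xpair_eqE defG ra rb rc rab rca rcb !eqxx.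
Qed.

Lemma Gp_rels_joing (p m n d : nat) (gT : finGroupType) (a b c : gT)
    (abc : Gp_rels p m n d a b c) :
  <[a]> <*> <[b]> <*> <[c]> = <[a]> * <[b]> * <[c]>.
Proof.
have [_ _ _ rab [rca rcb]] := abc.
have cca : <[c]> \subset 'C(<[a]>).
  by rewrite cent_cycle cycle_subG; apply/cent1P/commgP/conjg_fixP.
have ccb : <[c]> \subset 'C(<[b]>).
  by rewrite cent_cycle cycle_subG; apply/cent1P/commgP/conjg_fixP.
have nb : <[b]> \subset 'N(<[a]> <*> <[c]>).
  rewrite cycle_subG inE conjYg -!cycleJ rab rcb join_subG joing_subr andbT.
  rewrite cycle_subG groupM // -cycle_subG ?joing_subl ?joing_subr //.
rewrite -joingA (joingC <[b]>) joingA norm_joinEr //= cent_joinEr //.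
rewrite -!mulgA; congr (_ * _).
by rewrite (centC ccb).
Qed.

Section Generators.

Variables (p m n d : nat) (gT : finGroupType) (a b c : gT).

(** Every element has coordinates because of the factorization; the lower bound
    on the order leaves no room for two coordinate triples of one element. *)
Lemma Gp_rels_generators (abc : Gp_rels p m n d a b c) :
    0 < p ->
    [set: gT] = <[a]> * <[b]> * <[c]> -> p ^ (m + n + d) <= #|gT| ->
  Gp_generators p m n d a b c.
Proof.
move=> p_gt0 defG cardG; have [ra rb rc rab [rca rcb]] := abc; split=> //.
pose f (k : 'I_(p ^ m) * 'I_(p ^ n) * 'I_(p ^ d)) :=
  a ^+ k.1.1 * b ^+ k.1.2 * c ^+ k.2.
have f_onto x : x \in codom f.
  have: x \in <[a]> * <[b]> * <[c]> by rewrite -defG inE.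
  case/mulsgP=> _ _ /mulsgP[_ _ /cycleP[i ->] /cycleP[j ->] ->]
    /cycleP[k ->] ->.
  have lt_mod e l : l %% p ^ e < p ^ e by rewrite ltn_pmod // expn_gt0 p_gt0.
  apply/codomP.
  exists (Ordinal (lt_mod m i), Ordinal (lt_mod n j), Ordinal (lt_mod d k)).
  by rewrite /f /= !expg_mod.
have f_inj : injective f.
  have: #|codom f| == #|{: 'I_(p ^ m) * 'I_(p ^ n) * 'I_(p ^ d)}|.
    have cardT: #|codom f| = #|gT| by apply: eq_card => x; rewrite f_onto.
    by rewrite eqn_leq leq_image_card cardT !card_prod !card_ord -!expnD.
  by move/image_injP=> f_inj k k'; apply: f_inj.
move=> x; have /codomP[k def_x] := f_onto x.
by exists k; split=> // k' def_x'; apply: f_inj; rewrite -[RHS]def_x' -def_x.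
Qed.

Hypothesis abc : Gp_generators p m n d a b c.

Lemma Gp_generators_rels : Gp_rels p m n d a b c.
Proof. by case: abc. Qed.

Lemma Gp_generators_inj i j k i' j' k' :
    i < p ^ m -> j < p ^ n -> k < p ^ d ->
    i' < p ^ m -> j' < p ^ n -> k' < p ^ d ->
    a ^+ i * b ^+ j * c ^+ k = a ^+ i' * b ^+ j' * c ^+ k' ->
  [/\ i = i', j = j' & k = k'].
Proof.
move=> hi hj hk hi' hj' hk' eq_x.
have [l [_ uniq_l]] := Gp_coef abc (a ^+ i * b ^+ j * c ^+ k).
have := uniq_l (Ordinal hi, Ordinal hj, Ordinal hk) erefl.
by rewrite (uniq_l (Ordinal hi', Ordinal hj', Ordinal hk') eq_x) => -[].
Qed.

Lemma Gp_generators_card : #|[set: gT]| = (p ^ (m + n + d))%N.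
Proof.
pose f (k : 'I_(p ^ m) * 'I_(p ^ n) * 'I_(p ^ d)) :=
  a ^+ k.1.1 * b ^+ k.1.2 * c ^+ k.2.
have f_inj : injective f.
  case=> [[i j] k] [[i' j'] k'] /= eq_f.
  have [] //= := Gp_generators_inj _ _ _ _ _ _ eq_f.
  by move=> /val_inj-> /val_inj-> /val_inj->.
rewrite !expnD -[(p ^ m)%N]card_ord -[(p ^ n)%N]card_ord -[(p ^ d)%N]card_ord.
rewrite -!card_prod -(card_codom f_inj).
apply: eq_card => x; rewrite inE; apply/esym/codomP.
by have [k [def_x _]] := Gp_coef abc x; exists k.
Qed.

Hypothesis p_prime : prime p.

Lemma Gp_generators_pgroup : p.-group [set: gT].
Proof. by rewrite /pgroup Gp_generators_card pnatX pnat_id. Qed.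

Lemma Gp_generators_expa k : k < p ^ m -> a ^+ k = 1 -> k = 0.
Proof.
move=> lt_k ak.
have pX e : 0 < p ^ e by rewrite expn_gt0 prime_gt0.
have := @Gp_generators_inj k 0 0 0 0 0 lt_k (pX _) (pX _) (pX _) (pX _) (pX _).
by rewrite ak !expg0 !mulg1 => -[].
Qed.

Lemma Gp_generators_neq1 : 0 < d -> c != 1.
Proof.
move=> d_gt0; apply/eqP=> c1.
have pX e : 0 < p ^ e by rewrite expn_gt0 prime_gt0.
have d1 : 1 < p ^ d by rewrite -(exp1n d) ltn_exp2r // prime_gt1.
have := @Gp_generators_inj 0 0 1 0 0 0 (pX _) (pX _) d1 (pX _) (pX _) (pX _).
by rewrite c1 => -[].
Qed.

Lemma Gp_generators_center : c \in 'Z([set: gT]).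
Proof.
have [_ _ _ rab [rca rcb]] := Gp_generators_rels.
rewrite inE inE /= -sub_cent1 (Gp_gen abc) -(Gp_rels_joing Gp_generators_rels).
rewrite !join_subG !cycle_subG; apply/andP.
split; first apply/andP; last exact: cent1id.
by split; apply/cent1P/commgP/conjg_fixP;
  apply/conjg_fixP/commgP/commute_sym/commgP/conjg_fixP.
Qed.

Lemma Gp_generators_commg : [~ a, b] = c.
Proof. by rewrite commgEl (Gp_ab abc) mulKg. Qed.

Lemma Gp_generators_der1 : [set: gT]^`(1) = <[c]>.
Proof.
apply/eqP; rewrite eqEsubset cycle_subG -{2}Gp_generators_commg.
rewrite mem_commg ?inE // andbT.
have nc : [set: gT] \subset 'N(<[c]>).
  apply: cents_norm; rewrite centsC cycle_subG.
  by case/setIP: Gp_generators_center.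
apply: der1_min => //.
have Nx x : x \in 'N(<[c]>) by apply: (subsetP nc).
rewrite /= (Gp_gen abc) -(Gp_rels_joing Gp_generators_rels).
rewrite !quotientY ?cycle_subG ?join_subG ?cycle_subG ?Nx //.
rewrite !quotient_cycle // (coset_id (cycle_id c)) cycle1 joingG1.
rewrite abelianY !cycle_abelian cent_cycle cycle_subG /=.
apply/cent1P/commgP; rewrite -morphR // -invg_comm Gp_generators_commg.
by apply/eqP/coset_id; rewrite groupV cycle_id.
Qed.

(** In class two, (x * y) ^+ k differs from x ^+ k * y ^+ k by the power
    'C(k, 2) of a commutator; for k = p ^ m with p odd, that binomial
    coefficient is a multiple of p ^ m, and so this power is trivial. *)
Lemma Gp_generators_exponent (x : gT) :
  odd p -> d <= n -> n <= m -> x ^+ (p ^ m)%N = 1.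
Proof.
move=> p_odd le_dn le_nm.
have [ra rb rc rab [rca rcb]] := Gp_generators_rels.
have: x \in <[a]> * <[b]> * <[c]> by rewrite -(Gp_gen abc) inE.
case/mulsgP=> _ _ /mulsgP[_ _ /cycleP[i ->] /cycleP[j ->] ->]
  /cycleP[k ->] ->.
have central (y z : gT) : y \in <[c]> -> commute z y.
  have: <[c]> \subset 'Z([set: gT]).
    by rewrite cycle_subG Gp_generators_center.
  by move/subsetP=> sZ /sZ/centerP[_ /(_ z (in_setT z))]; apply: commute_sym.
have cX e (y : gT) : d <= e -> y \in <[c]> -> y ^+ (p ^ e)%N = 1.
  move=> le_de /cycleP[l ->]; rewrite expgnAC -(subnK le_de) expnD mulnC.
  by rewrite expgM rc !expg1n.
have d_m := leq_trans le_dn le_nm.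
rewrite expgMn; last by apply: central; rewrite mem_cycle.
have comm_c y z : [~ y, z] \in <[c]>.
  by rewrite -Gp_generators_der1 mem_commg ?inE.
rewrite expMg_Rmul; try exact: central (comm_c _ _).
rewrite bin2odd ?oddX ?p_odd ?orbT // expgM (cX m _ d_m (comm_c _ _)) expg1n.
rewrite (cX m (c ^+ k)) ?mem_cycle // (expgnAC a) ra expg1n (expgnAC b).
by rewrite -(subnK le_nm) expnD mulnC expgM rb !expg1n !mulg1.
Qed.

End Generators.

(** The subgroup generated in the permutation model is a quotient of the
    presented group, which bounds the order of the latter from below. *)
Lemma isog_Gp_generators (p m n d : nat) (gT : finGroupType) :
    prime p -> 0 < d -> d <= n -> n <= m -> isog_Gp p m n d [set: gT] ->
  exists a b c : gT, Gp_generators p m n d a b c.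
Proof.
move=> p_prime d_gt0 le_dn le_nm isoG.
have /homg_GpP[a [b [c [abc defG]]]] := isoGrp_hom isoG.
have pX e f : e <= f -> p ^ e %| p ^ f by move=> le_ef; rewrite dvdn_exp2l.
have p1 e : 0 < e -> 1 < p ^ e.
  by move=> e_gt0; rewrite -(exp1n e) ltn_exp2r ?prime_gt1.
have n_gt0 := leq_trans d_gt0 le_dn; have m_gt0 := leq_trans n_gt0 le_nm.
have rels := heis_rels (p1 _ d_gt0) (pX _ _ (leq_trans le_dn le_nm))
  (pX _ _ le_dn) (p1 _ m_gt0) (p1 _ n_gt0).
set A := heisA _ _ _ in rels; set B := heisB _ _ _ in rels.
set C := heisC _ _ _ in rels.
have homH : (<[A]> <*> <[B]> <*> <[C]>)%G
    \homg Grp (a : b : c : (a ^+ (p ^ m)%N, b ^+ (p ^ n)%N, c ^+ (p ^ d)%N,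
                            a ^ b = a * c, c ^ a = c, c ^ b = c)).
  by apply/homg_GpP; exists A, B, C.
exists a, b, c; apply: Gp_rels_generators => //; first exact: prime_gt0.
  by rewrite -(Gp_rels_joing abc).
have := heis_card (p1 _ d_gt0) (p1 _ m_gt0) (p1 _ n_gt0).
rewrite -!expnD => /leq_trans; apply.
rewrite -cardsT dvdn_leq ?cardG_gt0 //; apply: card_homg.
by rewrite isoG.
Qed.

(** * The Frattini quotient of a p-group; square roots in odd order *)

Lemma pgroup_card_proper (p : nat) (gT : finGroupType) (H K : {group gT}) :
  prime p -> p.-group K -> H \proper K -> p * #|H| <= #|K|.
Proof.
move=> p_prime pK /properP[sHK [x Kx notHx]].
rewrite -(Lagrange sHK) mulnC leq_pmul2l //.
have [e def_i] := p_natP (pnat_dvd (dvdn_indexg K H) pK).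
rewrite def_i -{1}(expn1 p) leq_exp2l ?prime_gt1 // lt0n.
apply: contra notHx => /eqP e0; move/eqP: def_i.
by rewrite e0 indexg_eq1 => /subsetP->.
Qed.

Lemma joing_cycles_index_Phi (p : nat) (gT : finGroupType) (G : {group gT})
    (a b : gT) :
  prime p -> p.-group G -> <[a]> <*> <[b]> = G -> #|G : 'Phi(G)| <= p ^ 2.
Proof.
move=> p_prime pG defG.
have [sNa sNb] : <[a]> \subset 'N('Phi(G)) /\ <[b]> \subset 'N('Phi(G)).
  by apply/andP; rewrite -join_subG defG gFnorm.
have abQ := Phi_quotient_abelem pG; have [cQ expQ] := abelemP p_prime abQ.
have defQ : (<[a]> / 'Phi(G)) <*> (<[b]> / 'Phi(G)) = G / 'Phi(G).
  by rewrite -quotientY // defG.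
have le_p x : <[x]> \subset G -> <[x]> \subset 'N('Phi(G)) ->
    #|<[x]> / 'Phi(G)| <= p.
  move=> Gx Nx; rewrite quotient_cycle -?cycle_subG //.
  apply: dvdn_leq (prime_gt0 _) _ => //; rewrite order_dvdn expQ //.
  by rewrite mem_quotient // -cycle_subG.
have comm_ab : commute (<[a]> / 'Phi(G)) (<[b]> / 'Phi(G)).
  by apply/centC/(sub_abelian_cent2 cQ);
    rewrite quotientS // -defG ?joing_subl ?joing_subr.
rewrite -card_quotient ?gFnorm //.
apply: leq_trans (_ : #|(<[a]> / 'Phi(G)) * (<[b]> / 'Phi(G))| <= _).
  by rewrite -comm_joingE // defQ.
apply: leq_trans (_ : #|<[a]> / 'Phi(G)| * #|<[b]> / 'Phi(G)| <= _).
  by rewrite mul_cardG leq_pmulr.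
by rewrite -mulnn leq_mul // le_p // -defG ?joing_subl ?joing_subr.
Qed.

(** The strict inclusions Phi < Phi <y> < Phi <y> <x> multiply the order by
    p at least twice, which exhausts G / Phi; hence x and y generate G modulo
    Phi, and so G itself. *)
Lemma joing_cycles_from_subgroup (p : nat) (gT : finGroupType)
    (G L : {group gT}) (a b x y : gT) :
    prime p -> p.-group G -> <[a]> <*> <[b]> = G -> 'Phi(G) \subset L ->
    x \in G -> x \notin L -> y \in G -> y \in L -> y \notin 'Phi(G) ->
  <[x]> <*> <[y]> = G.
Proof.
move=> p_prime pG defG sPL Gx Lx Gy Ly Py.
have := joing_cycles_index_Phi p_prime pG defG.
pose Y := ('Phi(G) <*> <[y]>)%G; pose H := (Y <*> <[x]>)%G.
have sYG : Y \subset G by rewrite join_subG gFsub cycle_subG.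
have sHG : H \subset G by rewrite join_subG sYG cycle_subG.
have ltPY : 'Phi(G) \proper Y.
  by rewrite properEneq joing_subl andbT; apply: contra Py => /eqP->;
     rewrite -cycle_subG joing_subr.
have ltYH : Y \proper H.
  rewrite properE joing_subl; apply: contra Lx => sHY.
  have/subsetP-> // : Y \subset L by rewrite join_subG sPL cycle_subG.
  by apply: (subsetP sHY); rewrite -cycle_subG joing_subr.
have cY := pgroup_card_proper p_prime (pgroupS sYG pG) ltPY.
have cH := pgroup_card_proper p_prime (pgroupS sHG pG) ltYH.
have p_gt0 := prime_gt0 p_prime.
rewrite -(leq_pmul2l (cardG_gt0 'Phi(G))) Lagrange ?gFsub // => cG.
have eqHG : H = G :> {set gT}.
  apply/eqP; rewrite eqEcard sHG (leq_trans cG) // (leq_trans _ cH) //.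
  by rewrite mulnC -mulnn -mulnA leq_pmul2l.
rewrite -[RHS](@Phi_nongen _ _ (<[x]> <*> <[y]>)) ?genGid //.
by rewrite (joingC <[x]>) joingA.
Qed.

Lemma odd_sqrt (gT : finGroupType) :
  odd #|[set: gT]| -> exists h, forall x : gT, x ^+ h ^+ 2 = x.
Proof.
move=> oddG; exists (uphalf #|[set: gT]|) => x.
rewrite -expgM muln2 uphalfE halfK /= oddG /= subn0 expgS.
by rewrite expg_cardG ?inE ?mulg1.
Qed.

(** * Units and left multiplications *)

Section NearringTheory.

Variable R : finNearring1Type.
Implicit Types x y z u v : R.
Local Notation G := [set: R].
Local Notation L := (nrnonunits R).

Lemma nrmul_morphM x : {in G &, {morph nrmul x : y z / y * z}}.
Proof. by move=> y z _ _; apply: nrmulDr. Qed.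

Canonical nrmul_morphism x := Morphism (nrmul_morphM x).

Lemma nrmulr1 x : x ** 1 = 1.
Proof. exact: (morph1 (nrmul_morphism x)). Qed.

Lemma nrmulrV x y : x ** y^-1 = (x ** y)^-1.
Proof. by apply: (morphV (nrmul_morphism x)); rewrite inE. Qed.

Lemma nrmulrX x y k : x ** (y ^+ k) = (x ** y) ^+ k.
Proof. by apply: (morphX (nrmul_morphism x)); rewrite inE. Qed.

Lemma nrmulrR x y z : x ** [~ y, z] = [~ x ** y, x ** z].
Proof. by apply: (morphR (nrmul_morphism x)); rewrite inE. Qed.

Lemma nrunitsP u :
  reflect (exists v, u ** v = \id /\ v ** u = \id) (u \in nrunits R).
Proof.
rewrite inE; apply: (iffP existsP) => -[v].
  by case/andP=> /eqP uv /eqP vu; exists v.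
by case=> uv vu; exists v; rewrite uv vu !eqxx.
Qed.

Lemma nrunits1 : \id \in nrunits R.
Proof. by apply/nrunitsP; exists \id; rewrite nrmul1l. Qed.

Lemma nrmul_unit_transitive u y : u \in nrunits R -> exists x, x ** u = y.
Proof.
by case/nrunitsP=> v [_ vu]; exists (y ** v); rewrite -nrmulA vu nrmul1r.
Qed.

Lemma nrunits_expg u k y : u \in nrunits R -> u ^+ k = 1 -> y ^+ k = 1.
Proof.
by case/(nrmul_unit_transitive y) => x <- uk; rewrite -nrmulrX uk nrmulr1.
Qed.

Lemma id_notin_nonunits : \id \notin L.
Proof. by rewrite /nrnonunits in_setC nrunits1. Qed.

(** An endomorphism of a p-group maps Phi into Phi, so a unit in Phi would put
    all its images, that is all of G, in Phi. *)
Lemma Phi_sub_nonunits (p : nat) :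
  p.-group G -> \id != 1 :> R -> 'Phi(G) \subset L.
Proof.
move=> pG nz; apply/subsetP=> u Phi_u; rewrite inE; apply/negP=> unit_u.
have/subsetPn[y _ /negP[]] : ~~ (G \subset 'Phi(G)).
  have := @Phi_proper _ G; rewrite properE => /(_ _)/andP[] //.
  by apply: contra nz => /eqP G1; have := in_setT (\id : R); rewrite G1 inE.
have [x <-] := nrmul_unit_transitive y unit_u.
have: nrmul_morphism x @* 'Phi(G) \subset 'Phi(G).
  by rewrite (morphim_Phi _ pG) // (PhiS pG) // subsetT.
by move/subsetP; apply; apply: mem_morphim; rewrite ?inE.
Qed.

(** * Non-units outside the Frattini subgroup *)

Section NonunitsInPhi.

Variable p : nat.
Hypotheses (p_prime : prime p) (p_odd : odd p) (pG : p.-group G).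
Hypotheses (cycG' : cyclic G^`(1)) (cG' : G^`(1) \subset 'Z(G)).
Hypothesis (ntG' : G^`(1) != 1).
Hypotheses (L1R : (1 : R) \in L) (sLPhi : L \subset 'Phi(G)).

Definition nrneg x := (\id)^-1 ** x.
Local Notation alpha := nrneg.

Let oddG : odd #|G| := odd_pgroup_odd p_odd pG.

Lemma alphaK : involutive alpha.
Proof. by move=> x; rewrite /alpha nrmulA nrmulrV nrmul1r invgK nrmul1l. Qed.

Lemma alphaM : {morph alpha : x y / x * y}.
Proof. by move=> x y; apply: nrmulDr. Qed.

Lemma der1_sub_Phi : G^`(1) \subset 'Phi(G).
Proof. by rewrite (Phi_joing pG) joing_subl. Qed.

(** Multiplying alpha x = x on the right by the inverse of a unit x makes \id
    its own opposite, which is impossible in a nontrivial group of odd order. *)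
Lemma fixed_nonunit x : alpha x = x -> x \in L.
Proof.
move=> fix_x; rewrite inE; apply/negP=> /nrunitsP[y [xy _]].
have idV : (\id)^-1 = \id :> R.
  by rewrite -{2}xy -{1}fix_x /alpha -nrmulA xy nrmul1r.
have id1 : \id = 1 :> R.
  apply/eqP; rewrite -order_eq1.
  have: #[\id : R] %| 2 by rewrite order_dvdn expgS expg1 -{1}idV mulVg.
  have := oddSg (subsetT <[\id : R]>) (odd_pgroup_odd p_odd pG).
  rewrite /order; case: #|_| => [|[|[|n]]] // _ /dvdn_leq; rewrite ?ltnS; exact.
by move: L1R; rewrite inE -id1 nrunits1.
Qed.

(** If alpha preserves the coset of v, that coset contains a fixed point: as
    alpha inverts phi = v^-1 * alpha v, it fixes v times the square root of phi.
    Fixed points are non-units, so this one lies in Phi, and so does v. *)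
Lemma alpha_coset_Phi v : v^-1 * alpha v \in 'Phi(G) -> v \in 'Phi(G).
Proof.
set phi := _ * _ => Phi_phi; have [h sqrtP] := odd_sqrt oddG.
have alpha_phi : alpha phi = phi^-1.
  by rewrite alphaM alphaK invMg invgK {1}/alpha nrmulrV.
have alpha_v : alpha v = v * phi by rewrite mulKVg.
have wL : v * phi ^+ h \in L.
  apply: fixed_nonunit; rewrite alphaM alpha_v {1}/alpha nrmulrX.
  rewrite [_ ** phi]alpha_phi.
  by rewrite -{1}(sqrtP phi) expgS expg1 -!mulgA expgVn mulgV mulg1.
by rewrite -(groupMr _ (groupX h Phi_phi)) (subsetP sLPhi).
Qed.

(** The element v * alpha v is fixed modulo Phi, since alpha only exchanges its
    two factors. *)
Lemma alpha_neg_mod_Phi v : v * alpha v \in 'Phi(G).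
Proof.
apply: alpha_coset_Phi; apply: (subsetP der1_sub_Phi).
rewrite alphaM alphaK.
have -> : (v * alpha v)^-1 * (alpha v * v) = [~ alpha v, v].
  by rewrite commgEl conjgE invMg !mulgA.
by rewrite mem_commg ?inE.
Qed.

Lemma nrmul_der1 x y : y \in G^`(1) -> x ** y \in G^`(1).
Proof.
have: nrmul_morphism x @* G^`(1) \subset G^`(1).
  by rewrite morphim_der // dergS // subsetT.
by move=> /subsetP sG' G'y; apply: sG'; apply: mem_morphim; rewrite ?inE.
Qed.

(** Let x be fixed. If x is a p ^ k-th power of y modulo G', then
    x ^+ 2 = x * alpha x is the p ^ k-th power of y * alpha y, which lies in Phi
    and hence is a p-th power modulo G'; taking square roots, x is a
    p ^ k.+1-th power modulo G'. For p ^ k = #|G| this makes x trivial. *)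
Lemma fixed_der1 x : alpha x = x -> x \in G^`(1).
Proof.
move=> fix_x; pose q := coset G^`(1).
have NG y : y \in 'N(G^`(1)) by apply: (subsetP (gFnorm _ _)); rewrite inE.
have qM y z : q (y * z) = q y * q z by rewrite /q morphM.
have qX y k : q (y ^+ k) = q y ^+ k by rewrite /q morphX.
have cQ : abelian (G / G^`(1)) by apply: sub_der1_abelian.
have QT y : q y \in G / G^`(1) by rewrite mem_quotient ?inE.
have alpha_q y z : q y = q z -> q (alpha y) = q (alpha z).
  move=> qyz; rewrite -[y](mulgKV z) alphaM qM.
  rewrite [q (alpha (_ * _))]coset_id ?mul1g //.
  apply: nrmul_der1; apply: coset_idr; rewrite ?NG //.
  by apply: (mulIg (q z)); rewrite -qM mulgKV mul1g.
have PhiQ y : y \in 'Phi(G) -> exists t, q y = q t ^+ p.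
  move=> Phi_y.
  have: q y \in 'Phi(G) / G^`(1) by rewrite mem_quotient.
  rewrite (quotient_Phi pG) ?gFnorm // (Phi_Mho (quotient_pgroup _ pG) cQ).
  rewrite (MhoEabelian 1 (quotient_pgroup _ pG) cQ).
  by case/imsetP=> _ /morphimP[t _ _ ->] ->; exists t; rewrite expn1.
have [h sqrtP] := odd_sqrt oddG.
have step k : exists y, q x = q y ^+ (p ^ k)%N.
  elim: k => [|k [y def_x]]; first by exists x; rewrite expn0 expg1.
  have [t def_t] := PhiQ _ (alpha_neg_mod_Phi y).
  have x2 : q x ^+ 2 = q t ^+ (p ^ k.+1)%N.
    rewrite expgS expg1 expnS expgM -def_t qM expgMn; last exact: (centsP cQ).
    rewrite {1}def_x -{1}fix_x (alpha_q x (y ^+ (p ^ k)%N)) ?qX //.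
    by rewrite {1}/alpha nrmulrX qX.
  exists (t ^+ h).
  by rewrite qX -expgM mulnC expgM -x2 -expgM mulnC expgM -!qX sqrtP.
have [e def_e] := p_natP pG; have [y def_x] := step e.
apply: coset_idr; rewrite ?NG // [coset _ x]def_x -qX -def_e.
by rewrite expg_cardG ?inE // /q morph1.
Qed.

(** Left multiplication by the additive identity is idempotent, its values are
    fixed by alpha and so lie in G', and it kills G' because its image is
    abelian. *)
Lemma nrmul0r y : 1 ** y = 1 :> R.
Proof.
have fix0 z : 1 ** z \in G^`(1).
  by apply: fixed_der1; rewrite /alpha nrmulA nrmulr1.
have -> : 1 ** y = 1 ** (1 ** y) by rewrite nrmulA nrmulr1.
have: nrmul_morphism 1 @* G^`(1) \subset [1].
  rewrite morphim_der // (sameP trivgP derG1P).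
  apply: abelianS (cyclic_abelian cycG').
  by apply/subsetP=> _ /morphimP[z _ _ ->] /=.
move/subsetP=> /(_ (1 ** (1 ** y))) sG'1; apply/set1P/sG'1.
by apply: mem_morphim; rewrite ?inE.
Qed.

Lemma commgML x y z : [~ x * y, z] = [~ x, z] * [~ y, z].
Proof.
rewrite commMgJ; congr (_ * _); apply/conjg_fixP/commgP.
have: [~ x, z] \in 'Z(G) by rewrite (subsetP cG') // mem_commg ?inE.
by case/centerP=> _; apply; rewrite inE.
Qed.

Lemma commg_central x y : commute x [~ x, y].
Proof.
have: [~ x, y] \in 'Z(G) by rewrite (subsetP cG') // mem_commg ?inE.
by case/centerP=> _ cxy; apply/commute_sym/cxy; rewrite inE.
Qed.

(* Commutators raised to this power form an alternating bilinear pairing that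
   vanishes on Phi and still detects the derived subgroup. *)
Let k := #|G^`(1)| %/ p.

Lemma mul_p_k : (p * k)%N = #|G^`(1)|.
Proof.
rewrite mulnC divnK //.
by have [] := pgroup_pdiv (pgroupS (der_sub 1 G) pG) ntG'.
Qed.

Lemma commg_expgML x y z : [~ x * y, z] ^+ k = [~ x, z] ^+ k * [~ y, z] ^+ k.
Proof.
rewrite commgML expgMn //; apply: (centsP (cyclic_abelian cycG'));
  by rewrite mem_commg ?inE.
Qed.

Lemma commg_expgC x y : [~ y, x] ^+ k = ([~ x, y] ^+ k)^-1.
Proof. by rewrite -invg_comm expgVn. Qed.

(** Phi is generated by the central subgroup G' and by p-th powers, and p * k is
    the order of G'. *)
Lemma Phi_commg_expg phi x : phi \in 'Phi(G) -> [~ phi, x] ^+ k = 1.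
Proof.
have gS : group_set [set y | [~ y, x] ^+ k == 1].
  apply/group_setP; split=> [|y z]; rewrite !inE ?comm1g ?expg1n //.
  by move=> /eqP yk /eqP zk; rewrite commg_expgML yk zk mulg1.
have sub : 'Phi(G) \subset Group gS.
  rewrite (Phi_joing pG) join_subG; apply/andP; split.
    apply/subsetP=> g G'g; rewrite inE; have/centerP[_ cg] := subsetP cG' g G'g.
    by have/commgP/eqP-> := cg x (in_setT x); rewrite expg1n.
  rewrite (MhoE 1 pG) gen_subG; apply/subsetP=> _ /imsetP[y _ ->].
  rewrite inE expn1 commXg -?expgM; last exact: commg_central.
  rewrite mul_p_k; apply/eqP/expg_cardG.
  by rewrite mem_commg ?inE.
by move/(subsetP sub); rewrite inE => /eqP.
Qed.

(** Since u * alpha u is in Phi, the pairing turns alpha into a sign in each of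
    its two arguments, and the two signs cancel. *)
Lemma alpha_commg_expg x y : alpha [~ x, y] ^+ k = [~ x, y] ^+ k.
Proof.
have commg_alpha u v : [~ alpha u, v] ^+ k = [~ v, u] ^+ k.
  have/eqP := Phi_commg_expg v (alpha_neg_mod_Phi u).
  by rewrite commg_expgML -eq_invg_mul -commg_expgC => /eqP.
by rewrite [alpha _]nrmulrR !commg_alpha.
Qed.

Lemma alpha_der1_expg g : g \in G^`(1) -> alpha (g ^+ k) = g ^+ k.
Proof.
have alphaX h : alpha (h ^+ k) = alpha h ^+ k by apply: nrmulrX.
have gS : group_set [set h in G^`(1) | alpha (h ^+ k) == h ^+ k].
  apply/group_setP; split=> [|x y]; rewrite !inE.
    by rewrite group1 expg1n [alpha _]nrmulr1 eqxx.
  case/andP=> G'x /eqP fx /andP[G'y /eqP fy]; rewrite groupM //.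
  rewrite expgMn; last exact: (centsP (cyclic_abelian cycG')).
  by rewrite alphaM fx fy eqxx.
have sub : G^`(1) \subset Group gS.
  rewrite gen_subG; apply/subsetP=> _ /imset2P[x y _ _ ->].
  by rewrite inE mem_commg ?inE // alphaX alpha_commg_expg eqxx.
by move/(subsetP sub); rewrite inE => /andP[_ /eqP].
Qed.

(** The element z = c ^+ k has order p, where c generates G', and is fixed by
    alpha, so left multiplication by z has its image in the cyclic group G' and
    its kernel in Phi: G / Phi would be cyclic. *)
Lemma nonunits_sub_Phi_false : False.
Proof.
have [c defG'] := cyclicP cycG'.
have oc : (p * k)%N = #[c] by rewrite mul_p_k /order -defG'.
have k_gt0 : 0 < k.
  by have := cardG_gt0 G^`(1); rewrite -mul_p_k muln_gt0 => /andP[].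
pose z := c ^+ k.
have nz : z != 1.
  rewrite -order_dvdn -oc; apply: contraL (prime_gt1 p_prime) => /dvdn_leq.
  by move/(_ k_gt0); rewrite -leqNgt -{2}(mul1n k) leq_pmul2r.
have alpha_z : alpha z = z by rewrite alpha_der1_expg // defG' cycle_id.
pose f := nrmul_morphism z.
have ker_f : 'ker f \subset 'Phi(G).
  apply: subset_trans sLPhi; apply/subsetP=> x /morphpreP[_ /set1P /= zx].
  rewrite inE; apply/negP=> /nrunitsP[y [xy _]]; case/eqP: nz.
  by rewrite -[z]nrmul1r -xy nrmulA [z ** x]zx nrmul0r.
have cyc_im : cyclic (f @* G).
  apply: cyclicS cycG'; apply/subsetP=> _ /morphimP[x _ _ ->].
  by apply: fixed_der1; rewrite /alpha /= nrmulA [_ ** z]alpha_z.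
have cycG : cyclic G.
  have [w def_im] := cyclicP cyc_im.
  have: w \in f @* G by rewrite def_im cycle_id.
  case/morphimP=> x _ _ def_w; apply/cyclicP; exists x.
  rewrite -[<[x]>]genGid -[LHS](@Phi_nongen _ _ <[x]>) ?genGid //.
  apply/eqP; rewrite eqEsubset subsetT; apply/subsetP=> y _.
  have: f y \in <[w]> by rewrite -def_im mem_morphim ?inE.
  case/cycleP=> i fy; rewrite -[y](mulgKV (x ^+ i)) groupM //; last first.
    by rewrite mem_gen // inE mem_cycle orbT.
  apply: (subsetP (joing_subl _ _)); apply: (subsetP ker_f).
  apply/kerP; rewrite ?inE // morphM ?inE // morphV ?inE // morphX ?inE //.
  by rewrite -def_w fy mulgV.
by case/eqP: ntG'; apply/derG1P; apply: cyclic_abelian.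
Qed.

End NonunitsInPhi.

Lemma nonunits_not_sub_Phi (p : nat) :
    prime p -> odd p -> p.-group G -> cyclic G^`(1) ->
    G^`(1) \subset 'Z(G) -> G^`(1) != 1 -> (1 : R) \in L ->
  ~~ (L \subset 'Phi(G)).
Proof.
move=> p_prime p_odd pG cycG' cG' ntG' L1; apply/negP.
exact: (nonunits_sub_Phi_false p_prime p_odd pG).
Qed.

End NearringTheory.

(** * Subgroups containing the Frattini subgroup and b, but not a *)

Section MaximalSubgroup.

Variables (p m n d : nat) (gT : finGroupType) (a b c : gT) (L : {group gT}).
Hypothesis abc : Gp_generators p m n d a b c.
Hypotheses (p_prime : prime p) (sPhiL : 'Phi([set: gT]) \subset L).
Hypotheses (notLa : a \notin L) (Lb : b \in L).

Let pG := Gp_generators_pgroup abc p_prime.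

Let La_p : a ^+ p \in L.
Proof.
rewrite (subsetP sPhiL) // (Phi_joing pG) (subsetP (joing_subr _ _)) //.
by rewrite -[p in a ^+ p]expn1 Mho_p_elt ?inE // (mem_p_elt pG) ?inE.
Qed.

Let Lc : c \in L.
Proof.
rewrite (subsetP sPhiL) // (Phi_joing pG) (subsetP (joing_subl _ _)) //.
by rewrite (Gp_generators_der1 abc) cycle_id.
Qed.

Lemma Gp_mem_maximal i j k : (a ^+ i * b ^+ j * c ^+ k \in L) = (p %| i).
Proof.
rewrite (groupMr _ (groupX k Lc)) (groupMr _ (groupX j Lb)).
apply/idP/idP=> [Lai | /dvdnP[q ->]]; last first.
  by rewrite mulnC expgM groupX.
(* Otherwise i is prime to p, and a ^+ i generates <[a]>. *)
apply: contraR notLa => p'i.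
have: generator <[a]> (a ^+ i).
  rewrite generator_coprime; have pa : p.-nat #[a] := mem_p_elt pG (in_setT a).
  have [e def_e] := p_natP pa.
  by rewrite def_e coprimeXl // prime_coprime.
move/eqP=> defa; have:= cycle_id a; rewrite defa.
by apply: subsetP; rewrite cycle_subG.
Qed.

Lemma Gp_maximalE : L = <[a ^+ p]> * <[b]> * <[c]> :> {set gT}.
Proof.
apply/setP=> x; apply/idP/idP; last first.
  case/mulsgP=> _ _ /mulsgP[_ _ /cycleP[i ->] /cycleP[j ->] ->]
    /cycleP[k ->] ->.
  by rewrite -expgM Gp_mem_maximal dvdn_mulr.
have: x \in <[a]> * <[b]> * <[c]> by rewrite -(Gp_gen abc) inE.
case/mulsgP=> _ _ /mulsgP[_ _ /cycleP[i ->] /cycleP[j ->] ->]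
  /cycleP[k ->] ->.
rewrite Gp_mem_maximal => /dvdnP[q ->].
by rewrite mulnC expgM !mem_mulg ?mem_cycle.
Qed.

Lemma Gp_maximal_index : #|[set: gT] : L| = p.
Proof.
have nL : L <| [set: gT].
  apply: sub_der1_normal (subsetT _); apply: subset_trans sPhiL.
  by rewrite (Phi_joing pG) joing_subl.
have NL x : x \in 'N(L) by apply: (subsetP (normal_norm nL)); rewrite inE.
rewrite -card_quotient ?normal_norm //.
have -> : [set: gT] / L = <[coset L a]>.
  rewrite (Gp_gen abc) -(Gp_rels_joing (Gp_generators_rels abc)).
  rewrite !quotientY ?join_subG ?cycle_subG ?NL // !quotient_cycle //.
  rewrite (coset_id Lb) (coset_id Lc); apply/eqP.
  rewrite eqEsubset !join_subG subxx !cycle_subG !group1.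
  rewrite /= -cycle_subG.
  exact: subset_trans (joing_subl _ _) (joing_subl _ _).
rewrite -/#[_]; apply/prime_nt_dvdP => //.
  by rewrite order_eq1; apply: contra notLa => /eqP; apply: coset_idr.
by rewrite order_dvdn -morphX //=; apply/eqP/coset_id.
Qed.

End MaximalSubgroup.

(** * Generators of the additive group that contain the identity *)

Section ExistsGenerators.

Variables (p m n d : nat) (R : finNearring1Type).
Hypotheses (p_prime : prime p) (p_odd : odd p).
Hypotheses (d_gt0 : 0 < d) (le_dn : d <= n) (le_nm : n <= m).
Hypothesis localR : local_nearring R.
Local Notation L := (nrnonunits R).
Local Notation G := [set: R].
Variables (a b c : R).
Hypothesis abc : Gp_generators p m n d a b c.

Let pG := Gp_generators_pgroup abc p_prime.

Lemma Gp_id_neq1 : \id != 1 :> R.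
Proof.
apply: contraNneq (Gp_generators_neq1 abc p_prime d_gt0) => id1.
by rewrite -[c]nrmul1r id1 nrmulr1.
Qed.

Lemma Gp_nonunit_lt (x : R) : n < m -> x ^+ (p ^ n)%N = 1 -> x \in L.
Proof.
move=> lt_nm xpn; rewrite inE; apply/negP=> unit_x.
have lt_pn : p ^ n < p ^ m by rewrite ltn_exp2l // prime_gt1.
have := Gp_generators_expa abc p_prime lt_pn (nrunits_expg a unit_x xpn).
by apply/eqP; rewrite -lt0n expn_gt0 prime_gt0.
Qed.

Lemma Gp_joing_ab : <[a]> <*> <[b]> = G.
Proof.
apply/eqP; rewrite eqEsubset subsetT {1}(Gp_gen abc).
rewrite -(Gp_rels_joing (Gp_generators_rels abc)) !join_subG.
rewrite joing_subl joing_subr /=.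
rewrite cycle_subG -(Gp_generators_commg abc) groupR // -cycle_subG;
by rewrite ?joing_subl ?joing_subr.
Qed.

Lemma Gp_b_notin_Phi : b \notin 'Phi(G).
Proof.
apply: contra (Gp_generators_neq1 abc p_prime d_gt0) => Phi_b.
have defG : <[a]> = G.
  rewrite -[LHS]genGid; apply: Phi_nongen; apply/eqP; rewrite eqEsubset subsetT.
  apply: subset_trans (_ : <[a]> <*> <[b]> \subset _).
    by rewrite Gp_joing_ab.
  by rewrite (joingC <[a]>) genS // setUSS // cycle_subG.
rewrite -(Gp_generators_commg abc); apply/commgP/(centsP (cycle_abelian a)).
  exact: cycle_id.
by rewrite defG inE.
Qed.

(** If n < m, the generator b of the presentation is a non-unit; if n = m, the
    condition on the order is void and L only has to leave Phi. *)
Lemma Gp_nonunit_generator :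
  exists2 x : R, x \in L & x \notin 'Phi(G) /\ x ^+ (p ^ n)%N = 1.
Proof.
have [lt_nm | ge_nm] := ltnP n m.
  exists b; first by apply: Gp_nonunit_lt => //; apply: Gp_expb abc.
  by split; [apply: Gp_b_notin_Phi | apply: Gp_expb abc].
have eq_mn : m = n by apply/eqP; rewrite eqn_leq ge_nm.
have defG' := Gp_generators_der1 abc.
have /subsetPn[x Lx Phi'x] : ~~ (L \subset 'Phi(G)).
  apply: (nonunits_not_sub_Phi p_prime p_odd pG).
  - by rewrite defG' cycle_cyclic.
  - by rewrite defG' cycle_subG (Gp_generators_center abc).
  - by rewrite defG' cycle_eq1 (Gp_generators_neq1 abc).
  exact: (group1 (Group localR)).
exists x => //; split=> //; rewrite -eq_mn.
exact: (Gp_generators_exponent abc).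
Qed.

Lemma Gp_generators_id_nonunit :
  exists x y : R, Gp_generators p m n d \id x y /\ x \in L.
Proof.
have [x Lx [Phi'x xpn]] := Gp_nonunit_generator; exists x, [~ \id, x].
split=> //.
have expG y := Gp_generators_exponent abc y p_odd le_dn le_nm.
have G'y : [~ \id, x] \in <[c]>.
  by rewrite -(Gp_generators_der1 abc) mem_commg ?inE.
have Zy : [~ \id, x] \in 'Z(G).
  by apply: subsetP G'y; rewrite cycle_subG (Gp_generators_center abc).
have fixy z : [~ \id, x] ^ z = [~ \id, x].
  by apply/conjg_fixP/commgP; case/centerP: Zy => _; apply; rewrite inE.
have rels : Gp_rels p m n d \id x [~ \id, x].
  split=> //.
    by have /cycleP[i ->] := G'y; rewrite expgnAC (Gp_expc abc) expg1n.
  by rewrite commgEl mulKVg.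
have joinG : <[\id : R]> <*> <[x]> = G.
  apply: (joing_cycles_from_subgroup (L := Group localR)
            p_prime pG Gp_joing_ab) => //.
    exact: Phi_sub_nonunits pG Gp_id_neq1.
  - exact: in_setT.
  - exact: id_notin_nonunits.
  exact: in_setT.
apply: (Gp_rels_generators rels); first exact: prime_gt0.
  rewrite -(Gp_rels_joing rels) joinG; apply/esym/eqP.
  by rewrite eqEsubset subsetT joing_subl.
by rewrite -cardsT (Gp_generators_card abc).
Qed.

End ExistsGenerators.

(** * The non-units of the nearring *)

Theorem theorem2 (p m n d : nat) (R : finNearring1Type)
    (p_prime : prime p) (p_odd : odd p)
    (d_gt0 : (1 <= d)%N) (le_dn : (d <= n)%N) (le_nm : (n <= m)%N)
    (isoR : isog_Gp p m n d [set: R]) (localR : local_nearring R) :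
  let L := nrnonunits R in
  (exists b c : R, Gp_generators p m n d \id b c /\ b \in L) /\
  (forall a b c : R,
     a = \id -> Gp_generators p m n d a b c -> (n < m)%N \/ b \in L ->
     [/\ L = <[a ^+ p]> * <[b]> * <[c]>,
         #|[set: R] : L| = p,
         #|nrunits R| = (p ^ (m + n + d - 1) * (p - 1))%N
       & forall x1 x2 x3 : nat,
           (x1 < p ^ m)%N -> (x2 < p ^ n)%N -> (x3 < p ^ d)%N ->
           a ^+ x1 * b ^+ x2 * c ^+ x3 \in nrunits R <-> x1 <> 0 %[mod p]]).
Proof.
move=> L; split.
  have [a [b [c abc]]] := isog_Gp_generators p_prime d_gt0 le_dn le_nm isoR.
  exact: Gp_generators_id_nonunit abc.
move=> a b c def_a abc nm_or_Lb.
have Lb : b \in Group localR.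
  by case: nm_or_Lb => // lt_nm; apply: Gp_nonunit_lt abc _ lt_nm (Gp_expb abc).
have pG := Gp_generators_pgroup abc p_prime.
have sPhiL := Phi_sub_nonunits pG (Gp_id_neq1 p_prime d_gt0 abc).
have notLa : a \notin Group localR by rewrite def_a; apply: id_notin_nonunits.
have indexL := Gp_maximal_index (L := Group localR) abc p_prime sPhiL notLa Lb.
split.
- exact: (Gp_maximalE (L := Group localR) abc p_prime sPhiL notLa Lb).
- exact: indexL.
- have cardL := Lagrange (subsetT (Group localR)).
  have cardU : #|nrunits R| + #|L| = #|[set: R]| by rewrite cardsT cardsC.
  have cardG := Gp_generators_card abc.
  have defN : m + n + d = (m + n + d - 1).+1.
    by rewrite subn1 prednK // ltn_addl.
  have cardL' : #|L| = (p ^ (m + n + d - 1))%N.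
    apply/eqP; rewrite -(eqn_pmul2r (prime_gt0 p_prime)) -expnSr -defN -cardG.
    by rewrite -cardL /= indexL.
  by rewrite mulnBr muln1 -expnSr -defN -cardG -cardU cardL' addnK.
move=> x1 x2 x3 _ _ _.
have := Gp_mem_maximal (L := Group localR) abc p_prime sPhiL notLa Lb x1 x2 x3.
rewrite /= /nrnonunits in_setC => /(canRL negbK) ->.
by rewrite mod0n; split=> [/dvdnP notd /eqP/dvdnP | /eqP].
Qed.
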